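(* There exists an absolute constant $c>0$ such that for all integers $n\ge 1$ and $d\ge 1$, every depth $d+1$ formula computing the $\textsc{parity}$ function $x_1\oplus\cdots\oplus x_n$ on $n$ variables has size at least $\exp\big(c\,d\,(n^{1/d}-1)\big)$. (That is, depth $d+1$ formulas computing $\textsc{parity}$ have size $2^{\Omega(d(n^{1/d}-1))}$.)
   Context: A formula is a finite rooted tree whose leaves are labeled by literals ($x_i$ or $\neg x_i$) and whose internal nodes (gates) are labeled AND or OR, with unbounded fan-in; it computes a boolean function in the natural way. The size of a formula is its number of gates. The depth of a formula is the maximum number of gates on a leaf-to-root path (literals have depth 0). *)

(* Defs.v *)
From mathcomp Require Import all_boot all_order all_algebra.
From mathcomp Require Import all_classical all_reals all_analysis.

Set Implicit Arguments.
Unset Strict Implicit.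
Unset Printing Implicit Defensive.

Variant gate := AND | OR.

(* [Lit i b] is the literal x_i if b = true and its negation if b = false.
   Leaves carry literals only, so a gate has at least one child: its children
   are [f :: fs]. The fan-in is otherwise unbounded. *)
Inductive formula (n : nat) : Type :=
| Lit of 'I_n & bool
| Gate of gate & formula n & seq (formula n).

Fixpoint feval (n : nat) (x : 'I_n -> bool) (F : formula n) : bool :=
  match F with
  | Lit i b => if b then x i else ~~ x i
  | Gate AND f fs => feval x f && all (feval x) fs
  | Gate OR f fs => feval x f || has (feval x) fs
  end.

Fixpoint fsize (n : nat) (F : formula n) : nat :=
  match F with
  | Lit _ _ => 0
  | Gate _ f fs => (fsize f + sumn (map (@fsize n) fs)).+1
  end.

Fixpoint fdepth (n : nat) (F : formula n) : nat :=
  match F with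
  | Lit _ _ => 0
  | Gate _ f fs => (foldr maxn (fdepth f) (map (@fdepth n) fs)).+1
  end.

Definition parity (n : nat) (x : 'I_n -> bool) : bool :=
  \big[addb/false]_(i < n) x i.

Definition computes (n : nat) (F : formula n) (f : ('I_n -> bool) -> bool) :=
  forall x : 'I_n -> bool, feval x F = f x.

(* Main.v *)
Require Import Defs.
From mathcomp Require Import all_boot all_order all_algebra.
From mathcomp Require Import all_classical all_reals all_analysis.
From mathcomp Require Import lra ring.
Import Order.TTheory GRing.Theory Num.Theory.

Set Implicit Arguments.
Unset Strict Implicit.
Unset Printing Implicit Defensive.

(* Let D be decision-tree depth and R_p the random restriction that leaves each
   variable free with probability p. By the switching lemma, if all children of a
   gate have D <= k under R_q, then under R_p the gate has D >= t with probability at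
   most (16 (p/q) k)^t. Put q_j(a) = 1 / (C (C a)^j). By induction on j, a formula of
   depth j+1 and size s satisfies, for a > 2,
     P[D > a under R_{q_j(a)}] <= s exp (- (j+1) (a-2) / 2).
   The gain over a fixed threshold log s for all gates comes from letting a gate
   choose the threshold of its children according to the restriction: the thresholds
   b_i = a exp ((2-i)/(j+1)) are tried in turn, and when b_(i+1) fails but b_i
   succeeds, the loss in the bound for the children is made up for by the factor
   exp (- (2+i) a) in the switching lemma. As the failure bounds are linear in the
   size, they add up over the children without loss.
     For the parity of n variables, D >= 1 under R_{1/n} has probability at least 1/2,
   and the threshold b = n^(1/d) / (64 C) for the children of the top gate yields
   s >= exp (d (b-2) / 2) / 4. When n^(1/d) is bounded, it suffices that s >= n, which
   holds because a gate of size s is made constant by fixing at most s variables. *)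

(** * Restrictions, decision-tree depth and certificates *)

Section DecisionDepth.
Variable n : nat.

Definition cube := {ffun 'I_n -> bool}.
Definition restr := {ffun 'I_n -> option bool}.
Implicit Types (f g : cube -> bool) (x y : cube) (rho kappa T : restr).

Definition fill rho x : cube := [ffun i => odflt (x i) (rho i)].
Definition restr_fun rho f : cube -> bool := fun x => f (fill rho x).
Definition all_star : restr := [ffun=> None].
Definition assign rho (pi : 'I_n -> bool) (vs : seq 'I_n) : restr :=
  [ffun i => if i \in vs then Some (pi i) else rho i].
Definition point v b : restr := assign all_star (fun=> b) [:: v].
Definition compose rho kappa : restr :=
  [ffun i => if rho i is Some b then Some b else kappa i].
Definition supp rho : {set 'I_n} := [set i | rho i != None].

Lemma restr_fun_compose rho kappa f :
  restr_fun kappa (restr_fun rho f) = restr_fun (compose rho kappa) f.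
Proof.
apply/funext => x; congr f; apply/ffunP => i; rewrite !ffunE.
by case: (rho i).
Qed.

Lemma restr_fun_point rho v b f : rho v = None ->
  restr_fun (point v b) (restr_fun rho f) = restr_fun (assign rho (fun=> b) [:: v]) f.
Proof.
move=> rv; rewrite restr_fun_compose; apply: (congr1 (fun r => restr_fun r f)); apply/ffunP => i.
rewrite !ffunE inE; case: eqP => [->|_]; first by rewrite rv.
by case: (rho i).
Qed.

Definition constant_fun f := [forall x, forall y, f x == f y].

Lemma constant_funP f : reflect (forall x y, f x = f y) (constant_fun f).
Proof.
apply: (iffP forallP) => [h x y|h x].
  by apply/eqP; exact: (forallP (h x)).
by apply/forallP => y; apply/eqP.
Qed.

(* [depth_lt t f] says that the decision-tree depth of f is smaller than t; in
   particular it is false for t = 0. *)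
Fixpoint depth_lt t f :=
  if t is t'.+1 then
    constant_fun f || [exists v, forall b, depth_lt t' (restr_fun (point v b) f)]
  else false.

Lemma depth_lt_negb t f : depth_lt t (fun x => ~~ f x) = depth_lt t f.
Proof.
elim: t f => [//|t IH] f /=; congr orb.
  by apply: eq_forallb => x; apply: eq_forallb => y; rewrite (inj_eq negb_inj).
by apply: eq_existsb => v; apply: eq_forallb => b; apply: (IH (restr_fun (point v b) f)).
Qed.

Definition agree T x := [forall i, (T i == None) || (T i == Some (x i))].

Lemma agreeP T x : reflect (forall i b, T i = Some b -> x i = b) (agree T x).
Proof.
apply: (iffP forallP) => h i.
  by move=> b Tib; have := h i; rewrite Tib /= => /eqP [].
by case E: (T i) => [b|] //=; rewrite (h _ _ E) eqxx.
Qed.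

(** The witness [T] records the answers on the branch of the decision tree that [x] follows. *)
Lemma depth_lt_certificate k f x : depth_lt k.+1 f ->
  exists T, [/\ #|supp T| <= k, agree T x & forall y, agree T y -> f y = f x].
Proof.
elim: k f => [|k IH] f; rewrite [depth_lt _ _]/=; case/orP.
- move/constant_funP => cf; exists all_star; split=> [||y _]; last exact: cf.
    by rewrite leqn0 cards_eq0; apply/eqP/setP => i; rewrite !inE !ffunE.
  by apply/agreeP => i b; rewrite ffunE.
- by case/existsP => v /forallP/(_ true).
- move/constant_funP => cf; exists all_star; split=> [||y _]; last exact: cf.
    by rewrite (_ : supp _ = finset.set0) ?cards0 //; apply/setP => i; rewrite !inE !ffunE.
  by apply/agreeP => i b; rewrite ffunE.
case/existsP => v /forallP/(_ (x v)) /IH [T [cT aT hT]].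
have fillx y : y v = x v -> fill (point v (x v)) y = y.
  move=> yv; apply/ffunP => i; rewrite !ffunE inE.
  by case: eqP => //= ->; rewrite yv.
exists (assign T x [:: v]); split.
- apply: (@leq_trans #|v |: supp T|).
    apply: subset_leq_card; apply/fintype.subsetP => i; rewrite !inE !ffunE inE.
    by have [->|/negbTE ne] := eqVneq i v; rewrite ?eqxx ?ne.
  by rewrite cardsU1; case: (v \notin _) => //=; rewrite add0n leqW.
- apply/agreeP => i b; rewrite !ffunE inE; case: eqP => [-> [//]|_ Tib].
  exact: (agreeP _ _ aT).
- move=> y /agreeP ay.
  have yv : y v = x v by apply: ay; rewrite ffunE inE eqxx.
  have := hT y; rewrite /restr_fun !fillx //; apply.
  apply/agreeP => i b Tib; apply: ay; rewrite ffunE inE; case: eqP => // ie.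
  by rewrite ie in Tib *; rewrite (agreeP _ _ aT _ _ Tib).
Qed.

(** Query all of [vs] first, then run the tree belonging to the answers. The encoding uses the
    contrapositive: some answers leave a deep function. *)
Lemma depth_lt_query rho f u vs : uniq vs -> all (fun v => rho v == None) vs ->
  (forall pi : cube, depth_lt u (restr_fun (assign rho pi vs) f)) ->
  depth_lt (u + size vs) (restr_fun rho f).
Proof.
elim: vs rho => [|v vs IH] rho /=.
  move=> _ _ /(_ [ffun=> true]).
  by rewrite addn0 (_ : assign _ _ _ = rho) //; apply/ffunP => i; rewrite ffunE.
case/andP => vvs uvs /andP[/eqP rv rvs] h.
rewrite addnS /=; apply/orP; right; apply/existsP; exists v; apply/forallP => b.
rewrite restr_fun_point //; apply: IH => //.
  apply/allP => w wvs; rewrite ffunE inE; case: (w =P v) => [we|_].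
    by rewrite -we wvs in vvs.
  exact: (allP rvs).
move=> pi; have := h [ffun i => if i == v then b else pi i].
apply: etrans; apply: (congr1 (fun r => depth_lt u (restr_fun r f))); apply/ffunP => i; rewrite !ffunE !inE.
case: eqP => [->|_] /=; first by rewrite (negbTE vvs).
by case: (i \in vs).
Qed.

End DecisionDepth.

Definition sem n (F : formula n) (x : cube n) : bool := feval x F.

(** * Razborov's encoding of the restrictions that leave a function deep *)

Section Encoding.
Variables (n k : nat) (v0 : 'I_n) (f : cube n -> bool).
Implicit Types (x y : cube n) (rho kappa T : restr n).

(** All implicants of width at most [k.+1], in the order of [enum], serve as the DNF of [f], so that
    the decoder knows it from [f] alone. *)
Definition implicant T :=
  (#|supp T| <= k.+1) && [forall y, agree T y ==> f y].
Definition alive rho T :=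
  [forall i, [|| T i == None, rho i == None | T i == rho i]].
Definition first_alive rho : restr n :=
  head (all_star n) [seq T <- enum (restr n) | implicant T && alive rho T].

(** A position in the current term, the bit given to the variable there, and a flag that closes the
    block of letters belonging to this term. *)
Definition letter := ('I_k.+1 * bool * bool)%type.

(* The variables that [code] re-frees. Terms are looked up in [kappa], which is
   only replaced by the updated restriction [kappa'] at the end of a block. *)
Fixpoint decode kappa kappa' (code : seq letter) : {set 'I_n} :=
  if code is (j, b, e) :: code' then
    let v := nth v0 (enum (supp (first_alive kappa))) j in
    let kappa1 := assign kappa' (fun=> b) [:: v] in
    v |: decode (if e then kappa1 else kappa) kappa1 code'
  else finset.set0.

Definition unfix (U : {set 'I_n}) kappa : restr n :=
  [ffun i => if i \in U then None else kappa i].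

Lemma aliveP rho T :
  reflect (forall i b c, T i = Some b -> rho i = Some c -> b = c) (alive rho T).
Proof.
apply: (iffP forallP) => [h i b c Ti ri|h i].
  by have := h i; rewrite Ti ri /= => /eqP [].
case E: (T i) => [b|] //=; case E': (rho i) => [c|] //=.
by rewrite (h _ _ _ E E') eqxx.
Qed.

Lemma first_aliveP rho : (exists T, implicant T && alive rho T) ->
  implicant (first_alive rho) /\ alive rho (first_alive rho).
Proof.
case=> T hT; have : T \in [seq T <- enum (restr n) | implicant T && alive rho T].
  by rewrite mem_filter hT mem_enum.
rewrite /first_alive; case E: [seq _ <- _ | _] => [//|T1 s] _ /=.
have : T1 \in [seq T <- enum (restr n) | implicant T && alive rho T].
  by rewrite E inE eqxx.
by rewrite mem_filter => /andP[/andP[]].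
Qed.

(** Extending a restriction can only kill terms, so no earlier term becomes alive. This lets the
    decoder find the term of [rho] from [kappa]. *)
Lemma first_alive_extend rho kappa : (exists T, implicant T && alive rho T) ->
  (forall i b, rho i = Some b -> kappa i = Some b) ->
  alive kappa (first_alive rho) -> first_alive kappa = first_alive rho.
Proof.
move=> ex ext; have [imp _] := first_aliveP ex; move: imp.
have sub T : alive kappa T -> alive rho T.
  move=> /aliveP h; apply/aliveP => i b c Ti ri.
  exact: h Ti (ext _ _ ri).
rewrite /first_alive; case: ex => T0 hT0.
have : has (fun T => implicant T && alive rho T) (enum (restr n)).
  by apply/hasP; exists T0; rewrite ?mem_enum.
elim: (enum _) => [//|T s IH] /=.
case: ifP => /= [hT _ imp al|hT h imp al]; first by rewrite imp al.
case: ifP => [/andP[i1 /sub i2]|_]; last exact: IH.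
by rewrite i1 i2 in hT.
Qed.

Definition letter_of T (pi : 'I_n -> bool) e v : letter :=
  (inord (index v (enum (supp T))), pi v, e).

Lemma nth_letter T v : #|supp T| <= k.+1 -> v \in supp T ->
  nth v0 (enum (supp T)) (inord (index v (enum (supp T))) : 'I_k.+1) = v.
Proof.
move=> cT vT; have vT' : v \in enum (supp T) by rewrite mem_enum.
by rewrite inordK ?nth_index // (leq_trans _ cT) // cardE index_mem.
Qed.

Lemma decode_block kappa kappa' T (pi : 'I_n -> bool) vs code :
  first_alive kappa = T -> #|supp T| <= k.+1 -> {subset vs <= supp T} ->
  decode kappa kappa' (map (letter_of T pi false) vs ++ code) =
  [set v in vs] :|: decode kappa (assign kappa' pi vs) code.
Proof.
move=> fT cT; elim: vs kappa' => [|v vs IH] kappa' sub /=.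
  rewrite (_ : [set v in [::]] = finset.set0); last by apply/setP => i; rewrite !inE.
  rewrite finset.set0U; congr decode; by apply/ffunP => i; rewrite !ffunE.
rewrite fT nth_letter ?sub ?mem_head // IH; last first.
  by move=> w wvs; apply: sub; rewrite inE wvs orbT.
rewrite finset.setUA; congr (_ :|: _).
  by apply/setP => i; rewrite !inE.
congr decode; apply/ffunP => i; rewrite !ffunE !inE.
by case: eqP => [->|_] //=; case: (v \in vs).
Qed.

Lemma decode_last_block kappa T (pi : 'I_n -> bool) vs v code :
  first_alive kappa = T -> #|supp T| <= k.+1 -> {subset rcons vs v <= supp T} ->
  decode kappa kappa
    (map (letter_of T pi false) vs ++ letter_of T pi true v :: code) =
  [set w in rcons vs v] :|: decode (assign kappa pi (rcons vs v))
                              (assign kappa pi (rcons vs v)) code.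
Proof.
move=> fT cT sub; rewrite (decode_block _ _ _ fT) //; last first.
  by move=> w wvs; apply: sub; rewrite mem_rcons inE wvs orbT.
rewrite /= fT nth_letter //; last by apply: sub; rewrite mem_rcons mem_head.
rewrite finset.setUA; congr (_ :|: _).
  by apply/setP => i; rewrite !inE mem_rcons inE orbC.
rewrite (_ : assign (assign _ _ _) _ _ = assign kappa pi (rcons vs v)) //.
apply/ffunP => i; rewrite !ffunE mem_rcons !inE.
by case: eqP => [->|_].
Qed.

Hypothesis f_dnf : forall x, f x ->
  exists T, [/\ #|supp T| <= k.+1, agree T x & forall y, agree T y -> f y].

(** Induction on [t], one block per term. The code keeps the answers of a deep branch, while [kappa]
    fixes free variables of each term in agreement with it, so that the decoder still recognises the
    term. *)
Lemma encode t rho : ~~ depth_lt t (restr_fun rho f) ->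
  exists code kappa, let U := decode kappa kappa code in
  [/\ size code = t, #|U| = t, {subset U <= supp kappa} & rho = unfix U kappa].
Proof.
elim/ltn_ind: t rho => -[|t] IH rho deep.
  exists [::], rho; split=> //=; first by rewrite cards0.
    by move=> i; rewrite inE.
  by apply/ffunP => i; rewrite ffunE inE.
have exT : exists T, implicant T && alive rho T.
  have [x fx] : exists x, restr_fun rho f x.
    move: deep => /=; rewrite negb_or => /andP[nc _]; apply/existsP.
    apply: contraNT nc; rewrite negb_exists => /forallP h.
    by apply/constant_funP => x y; rewrite !(negbTE (h _)).
  have [T [cT aT hT]] := f_dnf fx.
  exists T; rewrite /implicant cT /=; apply/andP; split.
    by apply/forallP => y; apply/implyP => /hT.
  apply/aliveP => i b c Ti ri; have := agreeP _ _ aT _ _ Ti.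
  by rewrite ffunE ri.
have [/andP[]] := first_aliveP exT.
set T := first_alive rho => cT /forallP impT /aliveP alT.
pose S := [set i in supp T | rho i == None].
pose tau i := odflt false (T i).
have TS i : i \in S -> T i = Some (tau i).
  by rewrite !inE /tau; case: (T i).
have first_ext kappa : (forall i b, rho i = Some b -> kappa i = Some b) ->
    (forall i, i \in S -> kappa i = None \/ kappa i = T i) -> first_alive kappa = T.
  move=> ext kS; apply: first_alive_extend => //.
  apply/aliveP => i b c Ti ki; have [iS|niS] := boolP (i \in S).
    by case: (kS i iS); rewrite ki // Ti => -[].
  move: niS; rewrite !inE -/T Ti /=; case E: (rho i) => [c'|] // _.
  by rewrite (ext _ _ E) in ki; case: ki => <-; exact: alT Ti E.
have Spos : 0 < #|S|.
  rewrite lt0n cards_eq0; apply: contraNneq deep => S0 /=.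
  apply/orP; left; apply/constant_funP.
  suff h x : restr_fun rho f x by move=> x y; rewrite !h.
  have := impT (fill rho x); move/implyP; apply.
  apply/agreeP => i b Ti; rewrite ffunE.
  have : i \notin S by rewrite S0 inE.
  rewrite !inE Ti /=; case E: (rho i) => [c|] //= _.
  by rewrite (alT _ _ _ Ti E).
have uS := enum_uniq (mem S).
have subS : {subset enum S <= supp T}.
  by move=> v; rewrite mem_enum inE => /andP[].
(* If the term has enough free variables, its block is cut to [t.+1] letters. Nothing is decoded
   after it, so its bits are arbitrary and no flag is raised. *)
have [le|lt] := leqP t.+1 #|S|.
  pose vs := take t.+1 (enum S).
  have vsS v : v \in vs -> v \in S by move/mem_take; rewrite mem_enum.
  have uvs : uniq vs by rewrite take_uniq.
  have svs : size vs = t.+1 by rewrite size_takel // -cardE.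
  have kT : first_alive (assign rho tau vs) = T.
    apply: first_ext => [i b ri|i iS]; rewrite ffunE.
      by case: ifP => // /vsS; rewrite !inE ri andbF.
    case: ifP => _; first by right; rewrite TS.
    by left; move: iS; rewrite !inE => /andP[_ /eqP].
  have subvs : {subset vs <= supp T} by move=> v /mem_take /subS.
  exists (map (letter_of T xpred0 false) vs ++ [::]), (assign rho tau vs).
  rewrite /= (decode_block _ _ _ kT cT subvs) /= finset.setU0; split.
  - by rewrite cats0 size_map.
  - by rewrite cardsE -svs; apply/card_uniqP.
  - by move=> v; rewrite !inE ffunE => ->.
  - apply/ffunP => i; rewrite !ffunE inE; have [/vsS|//] := boolP (i \in vs).
    by rewrite inE => /andP[_ /eqP].
have rS : all (fun v => rho v == None) (enum S).
  by apply/allP => v; rewrite mem_enum inE => /andP[].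
have [pi deep'] : exists pi : cube n,
    ~~ depth_lt (t.+1 - #|S|) (restr_fun (assign rho pi (enum S)) f).
  apply/existsP; rewrite -negb_forall; apply: contra deep => /forallP h.
  have := depth_lt_query uS rS h.
  by rewrite -cardE subnK // ltnW.
have [|code1 [kappa1 /=]] := IH (t.+1 - #|S|) _ _ deep'.
  by rewrite ltn_subrL Spos.
set U1 := decode _ _ _ => -[size1 card1 sub1 rho1].
have kap1 i : i \notin U1 -> kappa1 i = assign rho pi (enum S) i.
  by move=> iU; rewrite rho1 [RHS]ffunE (negbTE iU).
have SU1 i : i \in S -> i \notin U1.
  move=> iS; apply: contra_eqN (erefl (assign rho pi (enum S) i)) => iU.
  by rewrite {1}rho1 !ffunE iU mem_enum iS.
have rhoU1 i : i \in U1 -> rho i = None.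
  move=> iU; have := congr1 (fun r : restr n => r i) rho1.
  rewrite !ffunE iU mem_enum; case: ifP => // /SU1; by rewrite iU.
(* On [S], [kappa1] carries the answers [pi]. Overwriting them with [tau] keeps [T] alive, and the
   bits of the letters give [pi] back to the decoder. *)
pose kappa := assign kappa1 tau (enum S).
have kT : first_alive kappa = T.
  apply: first_ext => [i b ri|i iS]; rewrite ffunE mem_enum.
    case: ifP => [|iS]; first by rewrite !inE ri andbF.
    rewrite kap1 ?ffunE ?mem_enum ?iS //; apply/negP => /rhoU1; by rewrite ri.
  by rewrite iS TS //; right.
have [vs [v Evs]] : exists vs v, enum S = rcons vs v.
  case/lastP: (enum S) (cardE S) => [S0|vs v _]; first by rewrite S0 in Spos.
  by exists vs, v.
exists (map (letter_of T pi false) vs ++ letter_of T pi true v :: code1), kappa.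
have Ek : assign kappa pi (enum S) = kappa1.
  apply/ffunP => i; rewrite !ffunE mem_enum; have [iS|//] := boolP (i \in S).
  by rewrite kap1 ?SU1 // ffunE mem_enum iS.
rewrite /= (decode_last_block pi code1 kT cT) -?Evs // Ek -/U1.
have ES : [set v in enum S] = S by apply/setP => i; rewrite inE mem_enum.
rewrite ES; split.
- rewrite size_cat /= size_map addnS -addSn.
  have -> : (size vs).+1 = #|S| by rewrite cardE Evs size_rcons.
  by rewrite size1 subnKC // ltnW.
- rewrite cardsU card1 (_ : S :&: U1 = finset.set0) ?cards0 ?subn0 ?subnKC 1?ltnW //.
  by apply/setP => i; rewrite finset.in_setI finset.in_set0; apply/negP => /andP[/SU1/negP].
- move=> i; rewrite finset.in_setU => iSU; rewrite inE ffunE mem_enum.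
  by case: ifP iSU => // _ /sub1; rewrite inE.
- apply/ffunP => i; rewrite !ffunE mem_enum finset.in_setU.
  case: ifP => [/orP[|]|/norP[iS iU]].
  + by rewrite inE => /andP[_ /eqP].
  + exact: rhoU1.
  + by rewrite (negbTE iS) kap1 // ffunE mem_enum (negbTE iS).
Qed.

End Encoding.

(** A certificate for one true member certifies the disjunction; this supplies the DNF hypothesis of
    the switching lemma. *)
Lemma has_certificate n k (hs : seq (cube n -> bool)) x :
  all (depth_lt k.+1) hs -> has (fun h => h x) hs ->
  exists T, [/\ #|supp T| <= k, agree T x &
    forall y, agree T y -> has (fun h => h y) hs].
Proof.
elim: hs => [//|h hs IH] /= /andP[dh dhs] /orP[hx|/(IH dhs) [T [cT aT hT]]].
  have [T [cT aT hT]] := depth_lt_certificate x dh.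
  by exists T; split=> // y /hT ->; rewrite hx.
by exists T; split=> // y /hT ->; rewrite orbT.
Qed.

Local Open Scope ring_scope.

(** * Weights and probabilities of random restrictions *)

Section RandomRestriction.
Variables (R : realType) (n : nat).
Implicit Types (p q : R) (G H : restr n -> R) (A B : pred (restr n)).

Definition symbol_weight p (o : option bool) : R :=
  if o is Some _ then (1 - p) / 2 else p.
Definition weight p (rho : restr n) : R := \prod_i symbol_weight p (rho i).
Definition Ex p G : R := \sum_rho weight p rho * G rho.
Definition Pr p A : R := Ex p (fun rho => (A rho)%:R).

Lemma sum_option_bool (F : option bool -> R) :
  \sum_o F o = F None + F (Some true) + F (Some false).
Proof.
rewrite (bigD1 None) //= (bigD1 (Some true)) //= (bigD1 (Some false)) //=.
by rewrite big1 ?addr0 ?addrA // => -[[]|].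
Qed.

Lemma symbol_weight_ge0 p o : 0 <= p <= 1 -> 0 <= symbol_weight p o.
Proof. by case: o => [b|] /=; lra. Qed.

Lemma weight_ge0 p rho : 0 <= p <= 1 -> 0 <= weight p rho.
Proof. by move=> p01; apply: prodr_ge0 => i _; exact: symbol_weight_ge0. Qed.

Lemma sum_weight p : \sum_rho weight p rho = 1.
Proof.
rewrite /weight -(bigA_distr_bigA (fun=> symbol_weight p)) /= big1 // => i _.
by rewrite sum_option_bool /=; field.
Qed.

Lemma le_Ex p G H : 0 <= p <= 1 -> (forall rho, G rho <= H rho) -> Ex p G <= Ex p H.
Proof.
by move=> p01 GH; apply: ler_sum => rho _; apply: ler_wpM2l => //; exact: weight_ge0.
Qed.

Lemma ExD p G H : Ex p (fun rho => G rho + H rho) = Ex p G + Ex p H.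
Proof. by rewrite /Ex -big_split; apply: eq_bigr => rho _; rewrite mulrDr. Qed.

Lemma ExZ p a G : Ex p (fun rho => G rho * a) = Ex p G * a.
Proof. by rewrite /Ex mulr_suml; apply: eq_bigr => rho _; rewrite mulrA. Qed.

Lemma Ex_cst p a : Ex p (fun=> a) = a.
Proof. by rewrite /Ex -mulr_suml sum_weight mul1r. Qed.

Lemma Pr_ge0 p A : 0 <= p <= 1 -> 0 <= Pr p A.
Proof. by move=> p01; rewrite -(Ex_cst p 0); apply: le_Ex => // rho; rewrite ler0n. Qed.

Lemma Pr_le1 p A : 0 <= p <= 1 -> Pr p A <= 1.
Proof.
by move=> p01; rewrite -[X in _ <= X](Ex_cst p); apply: le_Ex => // rho; rewrite lern1 leq_b1.
Qed.

Lemma Pr_or p A B : 0 <= p <= 1 ->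
  Pr p (fun rho => A rho || B rho) <= Pr p A + Pr p B.
Proof.
move=> p01; rewrite -ExD; apply: le_Ex => // rho.
by case: (A rho); case: (B rho); rewrite /= ?addr0 ?add0r // lerDl.
Qed.

(** A coordinate is free in the composition exactly when both stages leave it free, hence the rate
    [p * q]. Weights factor over coordinates, which reduces the identity to a check on single
    symbols. *)
Lemma Ex_compose p q G :
  Ex (p * q) G = Ex p (fun rho => Ex q (fun kappa => G (compose rho kappa))).
Proof.
pose F (i : 'I_n) (eta : restr n) (o o' : option bool) : R :=
  symbol_weight p o * symbol_weight q o' *
  ((if o is Some b then Some b else o') == eta i)%:R.
have FE (eta rho kappa : restr n) : \prod_i F i eta (rho i) (kappa i) =
    weight p rho * weight q kappa * (compose rho kappa == eta)%:R.
  rewrite /F !big_split /=; congr (_ * _).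
  have [<-|ne] := eqVneq (compose rho kappa) eta.
    by rewrite big1 // => i _; rewrite ffunE eqxx.
  have [i ne_i] : exists i, compose rho kappa i != eta i.
    apply/existsP; apply: contraNT ne; rewrite negb_exists => /forallP h.
    by apply/eqP/ffunP => i; apply/eqP; have := h i; rewrite negbK.
  rewrite (bigD1 i) //=; move: ne_i; rewrite ffunE => /negbTE ->.
  by rewrite mul0r.
transitivity (\sum_(eta : restr n) \sum_(rho : restr n) \sum_(kappa : restr n)
    weight p rho * weight q kappa * (compose rho kappa == eta)%:R * G eta).
  apply: eq_bigr => eta _; under eq_bigr do rewrite -mulr_suml.
  rewrite -mulr_suml; congr (_ * _).
  under eq_bigr do under eq_bigr do rewrite -FE.
  under eq_bigr => rho _ do
    rewrite -(bigA_distr_bigA (fun i o' => F i eta (rho i) o')).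
  rewrite -(bigA_distr_bigA (fun i o => \sum_o' F i eta o o')).
  apply: eq_bigr => i _; rewrite !sum_option_bool /F /=.
  by case: (eta i) => [[]|] /=; field.
rewrite exchange_big; apply: eq_bigr => rho _; rewrite exchange_big /=.
rewrite mulr_sumr; apply: eq_bigr => kappa _.
rewrite (bigD1 (compose rho kappa)) //= big1 ?addr0.
  by rewrite eqxx mulr1 mulrA.
by move=> eta; rewrite eq_sym => /negbTE ->; rewrite mulr0 mul0r.
Qed.

(** Freeing a coordinate replaces the factor [(1 - p) / 2], which is at least [1 / 4], by [p]. *)
Lemma weight_unfix p (U : {set 'I_n}) kappa : 0 <= p <= 1 / 2 ->
  {subset U <= supp kappa} ->
  weight p (unfix U kappa) <= (4 * p) ^+ #|U| * weight p kappa.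
Proof.
move=> p01 sub; rewrite /weight.
have -> : (4 * p) ^+ #|U| = \prod_i (if i \in U then 4 * p else 1).
  by rewrite -big_mkcond /= prodr_const.
rewrite -big_split /=; apply: ler_prod => i _; rewrite ffunE.
have w0 o : 0 <= symbol_weight p o by apply: symbol_weight_ge0; lra.
case: ifP => [/sub|_]; last by rewrite mul1r lexx w0.
rewrite inE; case: (kappa i) => [b|] //= _; apply/andP; split; first by lra.
nra.
Qed.

End RandomRestriction.

(** * The switching lemma, for DNFs and for gates *)

Section Switching.
Variables (R : realType) (n k : nat) (v0 : 'I_n).

(* Razborov's encoding argument: the bad restrictions inject into pairs of a code
   and a restriction whose weight is larger by a factor (4p)^-t. *)
Lemma switching (f : cube n -> bool) t (p : R) : 0 <= p <= 1 / 2 ->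
  (forall x, f x -> exists T,
     [/\ (#|supp T| <= k.+1)%N, agree T x & forall y, agree T y -> f y]) ->
  Pr p (fun rho => ~~ depth_lt t (restr_fun rho f)) <= (16 * p * k.+1%:R) ^+ t.
Proof.
move=> p01 dnf; have p01' : 0 <= p <= 1 by lra.
pose good (c : t.-tuple (letter k)) kappa (U := decode v0 f kappa kappa c) :=
  (#|U| == t) && (U \subset supp kappa).
pose dec (c : t.-tuple (letter k)) kappa := unfix (decode v0 f kappa kappa c) kappa.
apply: (@le_trans _ _ (\sum_rho \sum_c \sum_kappa
   (good c kappa && (dec c kappa == rho))%:R * weight p rho)).
  apply: ler_sum => rho _; have w0 := weight_ge0 rho p01'.
  have sum0 c : 0 <= \sum_kappa
      (good c kappa && (dec c kappa == rho))%:R * weight p rho.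
    by apply: sumr_ge0 => kappa _; rewrite mulr_ge0 // ler0n.
  have [_|bad] := boolP (depth_lt t _); first by rewrite mulr0; apply: sumr_ge0.
  have [code [kappa [/eqP sz cU sU rhoE]]] := encode v0 dnf bad.
  rewrite mulr1 (bigD1 (Tuple sz)) //= (bigD1 kappa) //=.
  rewrite {1}/good /= cU eqxx (introT fintype.subsetP sU) /dec /= -rhoE eqxx mul1r.
  rewrite -addrA lerDl; apply: addr_ge0; last by apply: sumr_ge0.
  by apply: sumr_ge0 => kappa' _; rewrite mulr_ge0 // ler0n.
rewrite exchange_big /=.
apply: (@le_trans _ _ (\sum_(c : t.-tuple (letter k)) (4 * p) ^+ t)).
  apply: ler_sum => c _; rewrite exchange_big /=.
  rewrite -[leRHS]mulr1 -[X in _ <= _ * X](sum_weight n p) mulr_sumr; apply: ler_sum => kappa _.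
  rewrite (bigD1 (dec c kappa)) //= big1 ?addr0; last first.
    by move=> rho; rewrite eq_sym => /negbTE ->; rewrite andbF mul0r.
  rewrite eqxx andbT; have [/andP[/eqP cU sU]|_] := boolP (good c kappa).
    rewrite mul1r -[in X in _ <= X]cU; apply: weight_unfix => //.
    exact/fintype.subsetP.
  by rewrite mul0r mulr_ge0 ?weight_ge0 // exprn_ge0 // mulr_ge0 //; lra.
(* There are [4 * k.+1] letters, and each position of the code carries a factor [4 * p]; this is the
   constant 16. *)
rewrite sumr_const card_tuple !card_prod card_bool card_ord -[leLHS]mulr_natr natrX -exprMn.
rewrite !natrM; apply: lerXn2r; rewrite ?nnegrE; last by nra.
  by rewrite !mulr_ge0 //; lra.
by rewrite !mulr_ge0 //; lra.
Qed.

Lemma switching_or (hs : seq (cube n -> bool)) t (p : R) : 0 <= p <= 1 / 2 ->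
  all (depth_lt k.+2) hs ->
  Pr p (fun kappa => ~~ depth_lt t (restr_fun kappa (fun x => has (fun h => h x) hs)))
    <= (16 * p * k.+1%:R) ^+ t.
Proof. by move=> p01 dhs; apply: switching => // x; exact: has_certificate. Qed.

(** By De Morgan, an AND gate is the negation of an OR of negated children, and negation preserves
    decision-tree depth. *)
Lemma switching_gate g (f : formula n) fs rho t (p : R) : 0 <= p <= 1 / 2 ->
  all (fun h : formula n => depth_lt k.+2 (restr_fun rho (sem h))) (f :: fs) ->
  Pr p (fun kappa => ~~ depth_lt t
      (restr_fun (compose rho kappa) (sem (Gate g f fs))))
    <= (16 * p * k.+1%:R) ^+ t.
Proof.
move=> p01 dhs.
have [hs [dhs' hsE]] : exists hs, all (depth_lt k.+2) hs /\ forall kappa,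
    depth_lt t (restr_fun (compose rho kappa) (sem (Gate g f fs))) =
    depth_lt t (restr_fun kappa (fun x => has (fun h => h x) hs)).
  case: g.
    exists [seq (fun x => ~~ restr_fun rho (sem h) x) | h <- f :: fs]; split.
      by rewrite all_map; apply: sub_all dhs => h; apply: etrans; exact: (depth_lt_negb k.+2 (restr_fun rho (sem h))).
    move=> kappa; rewrite -restr_fun_compose -depth_lt_negb; congr depth_lt.
    apply/funext => x; rewrite /restr_fun /sem has_map.
    by rewrite -[feval _ _]/(all (feval (fill rho (fill kappa x))) (f :: fs)) -has_predC.
  exists [seq restr_fun rho (sem h) | h <- f :: fs]; split.
    by rewrite all_map.
  move=> kappa; rewrite -restr_fun_compose; congr depth_lt.
  by apply/funext => x; rewrite /restr_fun has_map.
apply: le_trans (switching_or t p01 dhs').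
by apply: le_Ex => [|kappa]; [lra|rewrite hsE].
Qed.

End Switching.

(** * Making gates constant, and the linear size bound for parity *)

Section GateCount.
Variable n : nat.
Implicit Types (rho kappa : restr n) (F h : formula n).

Lemma formula_nested_ind (P : formula n -> Prop) :
  (forall i b, P (Lit i b)) ->
  (forall g h hs, P h -> List.Forall P hs -> P (Gate g h hs)) ->
  forall F, P F.
Proof.
move=> PL PG; fix rec 1 => -[i b|g h hs]; first exact: PL.
apply: PG; first exact: rec.
by elim: hs => [|h' hs IH]; constructor.
Qed.

Definition extends rho kappa := forall i b, rho i = Some b -> kappa i = Some b.
Definition forces rho (f : cube n -> bool) b := forall x, restr_fun rho f x = b.

Lemma extends_trans rho1 rho2 rho3 :
  extends rho1 rho2 -> extends rho2 rho3 -> extends rho1 rho3.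
Proof. by move=> h1 h2 i b /h1/h2. Qed.

Lemma forces_extends rho kappa f b : extends rho kappa -> forces rho f b -> forces kappa f b.
Proof.
move=> ext fr x; rewrite -(fr (fill kappa x)); congr f; apply/ffunP => i.
by rewrite !ffunE; case E: (rho i) => [c|] //=; rewrite (ext _ _ E).
Qed.

Definition forceable rho f b (m : nat) :=
  exists kappa, [/\ extends rho kappa, (#|supp kappa| <= #|supp rho| + m)%N &
    forces kappa f b].

Lemma forceable_id rho f b m : forces rho f b -> forceable rho f b m.
Proof. by move=> fr; exists rho; split=> //; rewrite leq_addr. Qed.

Lemma forceable_le rho f b m m' : (m <= m')%N -> forceable rho f b m -> forceable rho f b m'.
Proof.
move=> le [kappa [ext card fr]]; exists kappa; split=> //.
by rewrite (leq_trans card) // leq_add2l.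
Qed.

Lemma eq_forces rho f g b c : (forall x, f x = b -> g x = c) ->
  forces rho f b -> forces rho g c.
Proof. by move=> fg fr x; apply: fg; exact: fr. Qed.

Lemma eq_forceable rho f g b c m : (forall x, f x = b -> g x = c) ->
  forceable rho f b m -> forceable rho g c m.
Proof. by move=> fg [kappa [ext card fr]]; exists kappa; split=> //; exact: eq_forces fr. Qed.

(* Fixing one child to the absorbing value c of its gate may cost one variable more
   than its size (a literal has size 0); this is paid for by the gate itself. *)
Definition cheap c h := forall rho,
  forceable rho (sem h) c (fsize h).+1 \/ forceable rho (sem h) (~~ c) (fsize h).

Lemma cheap_lit c i b : cheap c (Lit i b).
Proof.
move=> rho; pose v := if b then c else ~~ c.
case E: (rho i) => [d|].
  have fr : forces rho (sem (Lit i b)) (if b then d else ~~ d).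
    by move=> x; rewrite /restr_fun /sem /= ffunE E.
  have [e|ne] := eqVneq (if b then d else ~~ d) c.
    by left; apply: forceable_id; rewrite -e.
  right; apply: forceable_id; rewrite (_ : ~~ c = if b then d else ~~ d) //.
  by move: ne; clear; case: b c d => -[] [].
left; exists (assign rho (fun=> v) [:: i]); split.
- by move=> j e rj; rewrite ffunE inE; case: (j =P i) => // ji; rewrite ji E in rj.
- rewrite addn1; apply: (@leq_trans #|i |: supp rho|); last first.
    by rewrite cardsU1 -add1n leq_add2r leq_b1.
  apply/subset_leq_card/fintype.subsetP => j; rewrite !inE ffunE inE.
  by case: (j =P i).
- move=> x; rewrite /restr_fun /sem /= !ffunE inE eqxx /= /v.
  by case: (b); rewrite ?negbK.
Qed.

(** The children are treated in turn. One that can be forced to [c] settles the matter with one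
    extra variable; until then each is forced to [~~ c] at the cost of its size. *)
Lemma cheap_seq c hs : List.Forall (cheap c) hs -> forall rho,
  let f x := has (fun h => sem h x == c) hs in
  let m := sumn (map (@fsize n) hs) in
  forceable rho f true m.+1 \/ forceable rho f false m.
Proof.
elim=> [|h {}hs ch _ IH] rho /=.
  by right; apply: forceable_id => x.
case: (ch rho) => [fh|[kappa [ext card fr]]].
  left; apply: forceable_le (eq_forceable _ fh); first by rewrite ltnS leq_addr.
  by move=> x ->; rewrite eqxx.
have frx x : restr_fun kappa (sem h) x = ~~ c by exact: fr.
have step b m : forceable kappa (fun x => has (fun h => sem h x == c) hs) b m ->
    forceable rho (fun x => (sem h x == c) || has (fun h => sem h x == c) hs) b
      (fsize h + m).
  case=> kappa' [ext' card' fr']; exists kappa'; split.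
  - exact: extends_trans ext'.
  - by apply: (leq_trans card'); rewrite addnA leq_add2r.
  - move=> x; have := fr' x; have := forces_extends ext' fr x.
    by rewrite /restr_fun => -> ->; case: (c).
by case: (IH kappa) => /step; [left; rewrite -addnS|right].
Qed.

Lemma gate_forceable g h hs rho : (forall c, List.Forall (cheap c) (h :: hs)) ->
  exists b, forceable rho (sem (Gate g h hs)) b (fsize (Gate g h hs)).
Proof.
move=> ch; pose c := if g is AND then false else true.
have E x : sem (Gate g h hs) x = (has (fun h => sem h x == c) (h :: hs) == c).
  rewrite /c /sem; case: g {c} => /=.
    rewrite [RHS]eqbF_neg negb_or eqbF_neg negbK; congr andb.
    by rewrite -all_predC; apply: eq_all => h1 /=; rewrite eqbF_neg negbK.
  by rewrite !eqb_id; congr orb; apply: eq_has => h1; rewrite eqb_id.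
case: (cheap_seq (ch c) rho) => fo; [exists c|exists (~~ c)].
  by apply: eq_forceable fo => x; rewrite E => ->; case: (c).
apply: forceable_le (eq_forceable _ fo); first exact: leqnSn.
by move=> x; rewrite E => ->; case: (c).
Qed.

Lemma formula_cheap F c : cheap c F.
Proof.
elim/formula_nested_ind: F c => [i b|g h hs ch chs] c; first exact: cheap_lit.
move=> rho; have [d] : exists b, forceable rho (sem (Gate g h hs)) b (fsize (Gate g h hs)).
  apply: gate_forceable => c'; constructor => //.
  by elim: chs => [|h' hs' ch' _ IH]; constructor.
have [->|ne] := eqVneq d c => fo; first by left; apply: forceable_le fo.
by right; case: c d ne fo => -[].
Qed.

(** Flipping a free variable would flip the parity. *)
Lemma parity_constant rho :
  constant_fun (restr_fun rho (fun x => parity x)) -> forall i, rho i != None.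
Proof.
move=> /constant_funP cst i; apply/eqP => ri.
have := cst [ffun=> false] [ffun j => j == i].
rewrite /restr_fun /parity (bigD1 i) //= [RHS](bigD1 i) //= !ffunE ri /= eqxx.
rewrite (eq_bigr (fun j => fill rho [ffun j => j == i] j)); first by case: (\big[_/_]_(_ | _) _).
by move=> j /negbTE ji; rewrite !ffunE ji.
Qed.

(** A restriction making parity constant fixes all [n] variables. The root must be a gate: for
    [n = 1] a literal computes parity with size 0. *)
Lemma parity_size g h hs : computes (Gate g h hs) (@parity n) ->
  (n <= fsize (Gate g h hs))%N.
Proof.
move=> comp; have [|b [kappa [_ card fr]]] := @gate_forceable g h hs (all_star n).
  by move=> c; elim: (h :: hs) => [|h' hs' IH]; constructor => //; exact: formula_cheap.
have full : supp kappa = [set: 'I_n].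
  apply/setP => i; rewrite !inE; apply: parity_constant.
  by apply/constant_funP => x y; have := fr x; have := fr y;
    rewrite /restr_fun /sem !comp => -> ->.
move: card; rewrite full cardsT card_ord (_ : supp _ = finset.set0) ?cards0 //.
by apply/setP => i; rewrite !inE ffunE.
Qed.

End GateCount.

(** * Two-stage restrictions with a test in between *)

Section Refinement.
Variables (R : realType) (n : nat).
Implicit Types (p q r s : R) (A B D : pred (restr n)).

(** The probability that [B] fails after a first stage of rate [q] and [D] still holds after a
    second one of rate [r]. *)
Definition avoid q r B D : R :=
  Ex q (fun rho => (~~ B rho)%:R * Pr r (fun kappa => D (compose rho kappa))).

Lemma composeA (rho1 rho2 rho3 : restr n) :
  compose rho1 (compose rho2 rho3) = compose (compose rho1 rho2) rho3.
Proof. by apply/ffunP => i; rewrite !ffunE; case: (rho1 i). Qed.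

Lemma Pr_avoid q r B D : 0 <= q <= 1 -> 0 <= r <= 1 ->
  Pr (q * r) D <= Pr q B + avoid q r B D.
Proof.
move=> q01 r01; rewrite /Pr Ex_compose -ExD; apply: le_Ex => // rho.
case: (B rho) => /=; last by rewrite add0r mul1r.
by rewrite mul0r addr0; exact: Pr_le1.
Qed.

Lemma avoid_le q r B D M : 0 <= q <= 1 -> 0 <= M ->
  (forall rho, ~~ B rho -> Pr r (fun kappa => D (compose rho kappa)) <= M) ->
  avoid q r B D <= M.
Proof.
move=> q01 M0 hM; rewrite -[leRHS](Ex_cst n q); apply: le_Ex => // rho.
by case: (B rho) (hM rho) => /= [_|/(_ isT)]; rewrite ?mul0r ?mul1r.
Qed.

(** The first stage is split into [q] and [s], and [B'] is tested after [q]. If [B'] holds, the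
    bound [M] still applies conditionally, so the factors multiply; if it fails, the test of [B] is
    dropped and the stages [s] and [r] merge. *)
Lemma avoid_refine q s r B B' D M :
  0 <= q <= 1 -> 0 <= s <= 1 -> 0 <= r <= 1 -> 0 <= M ->
  (forall rho, ~~ B rho -> Pr r (fun kappa => D (compose rho kappa)) <= M) ->
  avoid (q * s) r B D <= Pr q B' * M + avoid q (s * r) B' D.
Proof.
move=> q01 s01 r01 M0 hM; rewrite /avoid Ex_compose -ExZ -ExD; apply: le_Ex => // rho.
case: (B' rho) => /=; rewrite ?mul0r ?mul1r ?addr0 ?add0r.
  rewrite -[leRHS](Ex_cst n s); apply: le_Ex => // rho'.
  by case: (B _) (hM (compose rho rho')) => /= [_|/(_ isT)]; rewrite ?mul0r ?mul1r.
rewrite /Pr Ex_compose; apply: le_Ex => // rho'.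
under [leRHS]eq_bigr do rewrite composeA.
case: (B _) => /=; last by rewrite mul1r.
by rewrite mul0r; exact: Pr_ge0.
Qed.

End Refinement.

(** * The tail bound for the depth of restricted formulas *)

Section Tail.
Variables (R : realType) (n : nat) (v0 : 'I_n).
Implicit Types (a b p : R) (F h : formula n) (rho : restr n).

(** The 16 cancels the constant of the switching lemma; [expR 4] is what leaves [expR (- (2 + i))]
    in [jump_grid]. *)
Definition base : R := 16 * expR 4.
Definition rate j a : R := (base * (base * a) ^+ j)^-1.
(** Decision-tree depth is an integer, so for [a >= 0] exceeding [a] means reaching
    [(Num.truncn a).+1]. *)
Definition deep a h rho := ~~ depth_lt (Num.truncn a).+1 (restr_fun rho (sem h)).
Definition some_deep a hs rho := has (fun h => deep a h rho) hs.

Lemma base_ge16 : 16 <= base.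
Proof. by rewrite /base; have := @expR_ge1Dx R 4; lra. Qed.

Lemma rate_gt0 j a : 1 <= a -> 0 < rate j a.
Proof.
move=> a1; have b16 := base_ge16.
by rewrite invr_gt0 mulr_gt0 ?exprn_gt0 ?mulr_gt0 //; lra.
Qed.

Lemma rate_le1 j a : 1 <= a -> rate j a <= 1.
Proof.
move=> a1; have b16 := base_ge16.
have h : 1 <= base * (base * a) ^+ j.
  by apply: mulr_ege1; [lra|apply: exprn_ege1; nra].
by rewrite invf_le1 //; lra.
Qed.

Lemma rate_anti j a b : 1 <= a -> a <= b -> rate j b <= rate j a.
Proof.
move=> a1 ab; have b16 := base_ge16.
rewrite lef_pV2 ?posrE ?mulr_gt0 ?exprn_gt0 ?mulr_gt0 //; try lra.
rewrite ler_wpM2l ?lerXn2r ?nnegrE //; try nra.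
Qed.

Lemma Pr_some_deep (p E : R) a hs j : 0 <= p <= 1 ->
  (forall h, (fdepth h <= j)%N -> Pr p (deep a h) <= (fsize h)%:R * E) ->
  all (fun h => fdepth h <= j)%N hs ->
  Pr p (some_deep a hs) <= (sumn (map (@fsize n) hs))%:R * E.
Proof.
move=> p01 hE; elim: hs => [_|h hs IH /= /andP[dh dhs]].
  by rewrite /Pr /= Ex_cst mul0r.
apply: le_trans (Pr_or _ _ p01) _.
by rewrite natrD mulrDl lerD // ?hE // IH.
Qed.

Lemma fdepth_gate g h hs j : (fdepth (Gate g h hs) <= j.+1)%N ->
  all (fun h' : formula n => fdepth h' <= j)%N (h :: hs).
Proof.
rewrite /= ltnS; elim: hs => [|h' hs IH] /=; first by rewrite andbT.
by rewrite geq_max => /andP[-> /IH /andP[-> ->]].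
Qed.

(** As [1 <= b], [Num.truncn b] has the form [k.+1], and the children have depth at most
    [k.+1 <= b]. *)
Lemma switching_rate g h hs b p rho t : 1 <= b -> 0 <= p <= 1 / 2 ->
  ~~ some_deep b (h :: hs) rho ->
  Pr p (fun kappa => ~~ depth_lt t (restr_fun (compose rho kappa) (sem (Gate g h hs))))
    <= (16 * p * b) ^+ t.
Proof.
move=> b1 p01; rewrite /some_deep -all_predC => dhs.
have /andP[tb _] := truncn_itv (le_trans ler01 b1).
have tpos : (0 < Num.truncn b)%N by rewrite truncn_gt0.
move: tb dhs; rewrite /deep; case: (Num.truncn b) tpos => // k _ tb dhs.
apply: (@le_trans _ _ ((16 * p * k.+1%:R) ^+ t)).
  apply: switching_gate => //; apply: sub_all dhs => h' /=.
  by rewrite negbK.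
apply: lerXn2r; rewrite ?nnegrE ?mulr_ge0 //; try lra.
by rewrite ler_wpM2l // mulr_ge0 //; lra.
Qed.

Lemma lit_shallow a i (b : bool) rho : 1 <= a -> ~~ deep a (Lit i b) rho.
Proof.
move=> a1; rewrite /deep negbK.
have : (0 < Num.truncn a)%N by rewrite truncn_gt0.
case: (Num.truncn a) => // k _ /=; apply/orP; right; apply/existsP; exists i.
apply/forallP => c; apply/orP; left; apply/constant_funP => x y.
by rewrite /restr_fun /sem /= !ffunE inE eqxx.
Qed.

Lemma Pr_lit_deep p a i (b : bool) : 1 <= a -> Pr p (deep a (Lit i b)) = 0.
Proof.
move=> a1; rewrite /Pr -(Ex_cst n p 0); apply: eq_bigr => rho _.
by rewrite (negbTE (lit_shallow _ _ _ a1)).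
Qed.

Lemma expR_pow_le (x a : R) (t : nat) : 0 <= x -> a <= t%:R ->
  expR (- x) ^+ t <= expR (- (x * a)).
Proof.
by move=> x0 ta; rewrite -expRM_natl ler_expR mulrN lerN2 [_%:R * _]mulrC ler_wpM2l.
Qed.

Lemma truncnS_ge a : 0 <= a -> a <= (Num.truncn a).+1%:R.
Proof. by move=> a0; have /andP[_ /ltW] := truncn_itv a0. Qed.

(** The children of a gate are literals here, so a single switching step from the empty restriction
    with [b = 1] suffices. *)
Lemma tail_base F a : (fdepth F <= 1)%N -> 2 < a ->
  Pr (rate 0 a) (deep a F) <= (fsize F)%:R * expR (- (1 / 2 * (a - 2))).
Proof.
case: F => [i b|g h hs] dF a2; first by rewrite Pr_lit_deep ?mul0r //; lra.
have b16 := base_ge16.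
have rE : rate 0 a = expR (- 4) / 16.
  by rewrite /rate expr0 mulr1 /base expRN; field; rewrite expR_eq0.
have e4 : expR (- 4) <= 1 :> R by rewrite expR_le1; lra.
have e4p := expR_gt0 (- 4 : R).
have r12 : 0 <= rate 0 a <= 1 / 2 by rewrite rE; lra.
have shallow rho : ~~ some_deep 1 (h :: hs) rho.
  have := fdepth_gate dF; rewrite /some_deep; elim: (h :: hs) => [//|h' hs' IH] /=.
  case/andP; case: h' => // i b _ /IH h'; rewrite negb_or h' andbT.
  exact: lit_shallow.
have dstar : deep a (Gate g h hs) =
    (fun kappa => ~~ depth_lt (Num.truncn a).+1
       (restr_fun (compose (all_star n) kappa) (sem (Gate g h hs)))).
  apply/funext => rho; rewrite /deep (_ : compose _ _ = rho) //.
  by apply/ffunP => i; rewrite !ffunE.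
rewrite dstar; apply: le_trans (switching_rate _ _ _ r12 (shallow _)) _ => //.
have -> : 16 * rate 0 a * 1 = expR (- 4) by rewrite rE; field.
apply: (@le_trans _ _ (expR (- (1 / 2 * (a - 2))))).
  apply: le_trans (expR_pow_le _ (truncnS_ge _)) _; [lra|lra|].
  by rewrite ler_expR; lra.
by rewrite ler_peMl ?expR_ge0 // ler1n.
Qed.

Section Step.
Variables (j : nat) (g : gate) (h : formula n) (hs : seq (formula n)) (a : R).
Hypothesis (a2 : 2 < a).
Hypothesis depth_hs : all (fun h' => fdepth h' <= j.+1)%N (h :: hs).
Hypothesis IH : forall F b, (fdepth F <= j.+1)%N -> 2 < b ->
  Pr (rate j b) (deep b F) <= (fsize F)%:R * expR (- (j.+1%:R / 2 * (b - 2))).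

Let F := Gate g h hs.
Definition level : R := j.+1%:R.
Definition gate_size : R := (fsize F)%:R.
Definition target : R := expR (- ((level + 1) / 2 * (a - 2))).

(* At the scale i, the children are inspected at the threshold [grid i]; the scales
   are chosen so that 16 (rate j.+1 a / rate j (grid i)) (grid i) = exp (-2 - i). *)
Definition grid i : R := a * expR ((2 - i%:R) / level).
Definition jump i : R := rate j.+1 a / rate j (grid i).

Let level1 : 1 <= level. Proof. by rewrite ler1n. Qed.
Let size1 : 1 <= gate_size. Proof. by rewrite ler1n. Qed.
Let grid_gt0 i : 0 < grid i.
Proof. by have a2' := a2; rewrite /grid mulr_gt0 ?expR_gt0 //; lra. Qed.
Let base_gt0 : 0 < base. Proof. by have := base_ge16; lra. Qed.

Lemma grid_lower i : level * a + (2 - i%:R) * a <= level * grid i.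
Proof.
have [a2' level1' size1'] := And3 a2 level1 size1.
rewrite /grid mulrCA -mulrDl mulrC ler_wpM2l //; first by lra.
have -> : level + (2 - i%:R) = level * (1 + (2 - i%:R) / level) by field; lra.
by rewrite ler_wpM2l ?expR_ge1Dx //; lra.
Qed.

Lemma gridS i : grid i.+1 <= grid i.
Proof.
have [a2' level1' size1'] := And3 a2 level1 size1.
rewrite /grid ler_wpM2l ?ler_expR //; first by lra.
by rewrite ler_wpM2r ?invr_ge0 ?ler_int -?natr1; lra.
Qed.

Lemma jump_grid i : 16 * jump i * grid i = expR (- (2 + i%:R)).
Proof.
have [a2' level1' size1'] := And3 a2 level1 size1.
have E : expR ((2 - i%:R) / level) ^+ j.+1 = expR (2 - i%:R).
  by rewrite -expRM_natl; congr expR; rewrite -/level; field; lra.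
have E2 : expR (- (2 + i%:R)) = expR (2 - i%:R) / expR 4 :> R.
  by rewrite -expRN -expRD; congr expR; ring.
have g0 := grid_gt0 i; have b0 := base_gt0.
rewrite E2 -E /jump /rate invrK -/base.
have -> : expR 4 = base / 16 :> R by rewrite /base; field.
have -> : expR ((2 - i%:R) / level) = grid i / a by rewrite /grid; field; lra.
rewrite !exprS expr_div_n !exprMn; field.
by rewrite !expf_neq0 ?lt0r_neq0 //; lra.
Qed.

Lemma jump_itv i : 2 < grid i -> 0 <= jump i <= 1 / 2.
Proof.
have [a2' level1' size1'] := And3 a2 level1 size1.
move=> g2; have E := jump_grid i.
have e0 := expR_gt0 (- (2 + i%:R : R)).
have e1 : expR (- (2 + i%:R)) <= 1 :> R.
  by rewrite expR_le1; have : 0 <= i%:R :> R by []; lra.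
have jp : 0 < jump i by rewrite /jump divr_gt0 ?rate_gt0 //; lra.
by nra.
Qed.

Lemma deep_jump i rho : 2 < grid i -> ~~ some_deep (grid i) (h :: hs) rho ->
  Pr (jump i) (fun kappa => deep a F (compose rho kappa)) <=
  expR (- ((2 + i%:R) * a)).
Proof.
have [a2' level1' size1'] := And3 a2 level1 size1.
move=> g2 sh.
apply: le_trans (switching_rate _ _ _ (jump_itv g2) sh) _; first by lra.
rewrite jump_grid; apply: expR_pow_le; last by apply: truncnS_ge; lra.
by rewrite addr_ge0.
Qed.

Lemma Pr_grid i : 2 < grid i ->
  Pr (rate j (grid i)) (some_deep (grid i) (h :: hs)) <=
  gate_size * expR (- (level / 2 * (grid i - 2))).
Proof.
have [a2' level1' size1'] := And3 a2 level1 size1.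
move=> g2; apply: le_trans (Pr_some_deep _ (fun h' dh' => IH dh' g2) depth_hs) _.
  by rewrite (ltW (rate_gt0 _ _)) ?rate_le1 //; lra.
by rewrite ler_wpM2r ?expR_ge0 // ler_nat /gate_size /=.
Qed.

(** By [grid_lower], passing to scale [i.+1] loses at most [(i - 1) * a / 2] in the exponent, while
    switching at scale [i] gains [(2 + i) * a]. As [a > 2], a surplus of at least [i + 2] over the
    target remains, whence the geometric factor. *)
Lemma grid_term i :
  gate_size * expR (- (level / 2 * (grid i.+1 - 2))) * expR (- ((2 + i%:R) * a)) <=
  gate_size * target * 2^-1 ^+ i.+2.
Proof.
have [a2' level1' size1'] := And3 a2 level1 size1.
have i0 : 0 <= i%:R :> R by [].
have := grid_lower i.+1; rewrite (_ : 2 - i.+1%:R = 1 - i%:R); last first.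
  by rewrite -[i.+1]addn1 natrD; ring.
move=> low; have ia : 0 <= i%:R * (a - 2) by rewrite mulr_ge0 //; lra.
rewrite -!mulrA ler_wpM2l //.
apply: (@le_trans _ _ (target * expR (- i.+2%:R))).
  rewrite /target -!expRD ler_expR -[i.+2]addn2 natrD; lra.
rewrite ler_wpM2l ?expR_ge0 // expRN exprVn lef_pV2 ?posrE ?exprn_gt0 ?expR_gt0 //.
rewrite -[i.+2%:R]mulr1 expRM_natl; apply: lerXn2r; rewrite ?nnegrE ?expR_ge0 //.
by have := expR_ge1Dx (1 : R); lra.
Qed.

(** When the next threshold is at most 2, the children's bound there is at least 1, so the switching
    bound at scale [i] is itself below [grid_term]. *)
Lemma last_scale i : 2 < grid i -> grid i.+1 <= 2 ->
  avoid (rate j (grid i)) (jump i) (some_deep (grid i) (h :: hs)) (deep a F) <=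
  gate_size * target * 2^-1 ^+ i.+1.
Proof.
have [a2' level1' size1'] := And3 a2 level1 size1.
move=> g2 le; have q01 : 0 <= rate j (grid i) <= 1.
  by rewrite (ltW (rate_gt0 _ _)) ?rate_le1 //; lra.
apply: le_trans (avoid_le q01 (expR_ge0 _) (fun rho => deep_jump g2)) _.
have tgt : 0 <= gate_size * target * 2^-1 ^+ i.+2.
  by apply: mulr_ge0; [apply: mulr_ge0; [lra|exact: expR_ge0]|apply: exprn_ge0; lra].
apply: (@le_trans _ _ (gate_size * target * 2^-1 ^+ i.+2)); last first.
  move: tgt; rewrite exprS; set x := 2^-1 ^+ i.+1 => tgt; lra.
apply: le_trans (grid_term i); rewrite ler_peMl ?expR_ge0 // mulr_ege1 //.
by rewrite -[leLHS]expR0 ler_expR oppr_ge0; nra.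
Qed.

(** Induction on the number [m] of scales left. Failure of the children at scale [i.+1] takes half
    of the bound, by [grid_term]; the remaining event takes the other half, by induction. *)
Lemma avoid_grid m i : grid (i + m).+1 <= 2 -> 2 < grid i ->
  avoid (rate j (grid i)) (jump i) (some_deep (grid i) (h :: hs)) (deep a F) <=
  gate_size * target * 2^-1 ^+ i.+1.
Proof.
have [a2' level1' size1'] := And3 a2 level1 size1.
move=> + g2; have g1 : 1 <= grid i by lra.
elim: m i g2 g1 => [|m IHm] i g2 g1 gm.
  apply: (last_scale g2); by rewrite addn0 in gm.
have [|gt] := leP (grid i.+1) 2; first exact: last_scale.
have q01 k : 2 < grid k -> 0 <= rate j (grid k) <= 1.
  by move=> gk; rewrite (ltW (rate_gt0 _ _)) ?rate_le1 //; lra.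
have j01 k : 2 < grid k -> 0 <= jump k <= 1 by move=> /jump_itv; lra.
have r0 k : 2 < grid k -> rate j (grid k) != 0.
  by move=> gk; rewrite lt0r_neq0 // rate_gt0 //; lra.
(* The smaller threshold has the larger rate, so the restriction for [grid i] arises from that for
   [grid i.+1] by a further stage of rate [t]. *)
pose t := rate j (grid i) / rate j (grid i.+1).
have t01 : 0 <= t <= 1.
  have r1 : 0 < rate j (grid i.+1) by rewrite rate_gt0 //; lra.
  rewrite divr_ge0 ?(ltW r1) ?(ltW (rate_gt0 _ _)) //= ler_pdivrMr // mul1r.
  by apply: rate_anti (gridS i); lra.
have -> : rate j (grid i) = rate j (grid i.+1) * t by rewrite /t; field; exact: r0.
apply: le_trans (avoid_refine (some_deep (grid i.+1) (h :: hs)) (q01 _ gt) t01 (j01 _ g2)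
  (expR_ge0 _) (fun rho => deep_jump g2)) _.
have -> : t * jump i = jump i.+1 by rewrite /t /jump; field; rewrite !r0.
have half : gate_size * target * 2^-1 ^+ i.+1 =
    gate_size * target * 2^-1 ^+ i.+2 + gate_size * target * 2^-1 ^+ i.+2.
  by rewrite [in RHS]exprS; field.
rewrite half; apply: lerD.
  apply: le_trans (grid_term i); rewrite ler_wpM2r ?expR_ge0 //.
  exact: Pr_grid.
by apply: IHm => //; [lra|rewrite addSn -addnS].
Qed.

Lemma grid_eventually_small : exists i, grid i <= 2.
Proof.
have [a2' level1' size1'] := And3 a2 level1 size1.
(* This makes [(2 - i) / level] at most [- a], and [a * expR (- a) <= 2]. *)
exists (Num.truncn (level * a)).+3.
have Ja : 0 <= level * a by apply: mulr_ge0; lra.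
have /andP[_ lt] := truncn_itv Ja.
have := expR_ge1Dx a; set e := expR a => e1.
have e0 : 0 < e by exact: expR_gt0.
apply: (@le_trans _ _ (a * e^-1)); last by rewrite ler_pdivrMr //; lra.
rewrite ler_wpM2l -?expRN ?ler_expR //; first by lra.
by rewrite ler_pdivrMr; [rewrite -[_.+3]addn2 natrD; lra|lra].
Qed.

(** Half of the bound covers failure of the children at scale 0, whose threshold exceeds [a] by at
    least [2 * a / level]; [avoid_grid] covers the rest. *)
Lemma tail_step :
  Pr (rate j.+1 a) (deep a F) <= gate_size * expR (- (j.+2%:R / 2 * (a - 2))).
Proof.
have [a2' level1' size1'] := And3 a2 level1 size1.
have g0 : 2 < grid 0.
  have := grid_lower 0; rewrite subr0 => low.
  rewrite ltNge; apply/negP => le; have : level * grid 0 <= level * 2 by rewrite ler_wpM2l //; lra.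
  by nra.
have [i0 gi] := grid_eventually_small.
have r0 : 0 < rate j (grid 0) by rewrite rate_gt0 //; lra.
have -> : rate j.+1 a = rate j (grid 0) * jump 0 by rewrite /jump; field; lra.
have q01 : 0 <= rate j (grid 0) <= 1 by rewrite (ltW r0) rate_le1 //; lra.
have j01 : 0 <= jump 0 <= 1 by have := jump_itv g0; lra.
apply: le_trans (Pr_avoid (some_deep (grid 0) (h :: hs)) _ q01 j01) _.
have -> : expR (- (j.+2%:R / 2 * (a - 2))) = target.
  by rewrite /target /level -natr1.
have -> : gate_size * target = gate_size * (target / 2) + gate_size * target * 2^-1 ^+ 1.
  by rewrite expr1; field.
apply: lerD.
  apply: le_trans (Pr_grid g0) _; rewrite ler_wpM2l //.
  have low := grid_lower 0; rewrite subr0 in low.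
  apply: (@le_trans _ _ (target * expR (- 1))).
    by rewrite /target -expRD ler_expR; lra.
  rewrite ler_wpM2l ?expR_ge0 // expRN lef_pV2 ?posrE ?expR_gt0 //.
  by have := expR_ge1Dx (1 : R); lra.
case: i0 gi => [|i0] gi; first by lra.
exact: (@avoid_grid i0 0).
Qed.

End Step.

Lemma tail j F a : (fdepth F <= j.+1)%N -> 2 < a ->
  Pr (rate j a) (deep a F) <= (fsize F)%:R * expR (- (j.+1%:R / 2 * (a - 2))).
Proof.
elim: j F a => [|j IHj] F a; first exact: tail_base.
case: F => [i b|g h hs] dF a2; first by rewrite Pr_lit_deep ?mul0r //; lra.
apply: tail_step => //; exact: fdepth_gate dF.
Qed.

End Tail.

(** * The size bound for parity when there are many variables *)

Section Parity.
Variable R : realType.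

Lemma Pr_no_star n (p : R) :
  Pr p (fun rho : restr n => [forall i, rho i != None]) = (1 - p) ^+ n.
Proof.
transitivity (\sum_(rho : restr n)
    \prod_i (symbol_weight p (rho i) * (rho i != None)%:R)).
  apply: eq_bigr => rho _; rewrite big_split /=; congr (_ * _).
  have [/forallP h|] := boolP [forall i, rho i != None].
    by rewrite big1 // => i _; rewrite h.
  by rewrite negb_forall => /existsP[i ri]; rewrite (bigD1 i) //= (negbTE ri) mul0r.
rewrite -(bigA_distr_bigA (fun i o => symbol_weight p o * (o != None)%:R)) /=.
rewrite -[n in RHS]card_ord -prodr_const; apply: eq_bigr => i _.
by rewrite sum_option_bool /=; field.
Qed.

Lemma Pr_star_ge_half n : (0 < n)%N ->
  1 / 2 <= Pr (n%:R^-1 : R) (fun rho : restr n => ~~ [forall i, rho i != None]).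
Proof.
move=> n0; have n0' : 0 < n%:R :> R by rewrite ltr0n.
have n1 : 1 <= n%:R :> R by rewrite ler1n.
have i01 : 0 <= (n%:R^-1 : R) <= 1 by rewrite invr_ge0 ltW //= invf_le1.
have e : (1 - n%:R^-1) ^+ n <= 2^-1 :> R.
  apply: (@le_trans _ _ (expR (- n%:R^-1) ^+ n)).
    apply: lerXn2r; rewrite ?nnegrE ?expR_ge0 //; first by lra.
    exact: expR_ge1Dx.
  rewrite -expRM_natl mulrN mulfV ?lt0r_neq0 // expRN lef_pV2 ?posrE ?expR_gt0 //.
  by have := @expR_ge1Dx R 1; lra.
have : 1 <= Pr (n%:R^-1 : R) (fun rho : restr n => ~~ [forall i, rho i != None]) +
    Pr (n%:R^-1 : R) (fun rho : restr n => [forall i, rho i != None]).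
  rewrite -ExD -[leLHS](Ex_cst n n%:R^-1); apply: le_Ex => // rho.
  by case: [forall i, _]; rewrite /= ?addr0 ?add0r.
by rewrite Pr_no_star; lra.
Qed.

(** Parity stays nonconstant with probability at least 1/2. At most 1/4 of this arises while all
    children of the root are shallow, so a deep child has probability at least 1/4, which [tail]
    turns into a size bound. *)
Lemma parity_size_large n d (F : formula n) (b : R) : (0 < n)%N -> 2 < b ->
  fdepth F = d.+2 -> computes F (@parity n) ->
  (64 * base R * b) ^+ d.+1 = n%:R ->
  expR (d.+1%:R / 2 * (b - 2)) <= 4 * (fsize F)%:R.
Proof.
move=> n0 b2; case: F => // g h hs dF comp nE.
have B16 := base_ge16 R; have B0 : 0 < base R by lra.
have n1 : 1 <= n%:R :> R by rewrite ler1n.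
have i01 : 0 <= (n%:R^-1 : R) <= 1 by rewrite invr_ge0 ler0n /= invf_le1; lra.
have r0 : 0 < rate d b by apply: rate_gt0; lra.
have r01 : 0 <= rate d b <= 1 by rewrite (ltW r0) rate_le1 //; lra.
pose r : R := n%:R^-1 / rate d b.
have rb : 16 * r * b <= 1 / 4.
  (* By the choice of [b], [(base R * b) ^+ d.+1] equals [n / 64 ^+ d.+1]. *)
  have -> : 16 * r * b = 16 * 64^-1 ^+ d.+1.
    rewrite /r /rate -nE invrK; move: (base R) B0 => B B0.
    rewrite !exprMn !exprVn !exprS; field.
    by rewrite !expf_neq0 ?lt0r_neq0 //; lra.
  rewrite exprS; have : 64^-1 ^+ d <= 1 :> R by apply: exprn_ile1; lra.
  by lra.
have r12 : 0 <= r <= 1 / 2.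
  have : 0 <= r by rewrite divr_ge0 // ltW.
  by nra.
have bound := @Pr_avoid R n (rate d b) r (some_deep b (h :: hs))
  (fun rho => ~~ depth_lt 1 (restr_fun rho (sem (Gate g h hs)))) r01.
have rE : rate d b * r = n%:R^-1 by rewrite /r; field; rewrite !lt0r_neq0 //; lra.
rewrite rE in bound.
have lower : 1 / 2 <= Pr (n%:R^-1 : R)
    (fun rho => ~~ depth_lt 1 (restr_fun rho (sem (Gate g h hs)))).
  apply: le_trans (Pr_star_ge_half n0) _; apply: le_Ex => // rho.
  rewrite ler_nat; have [|_] := boolP (depth_lt 1 _); last exact: leq_b1.
  case/orP=> [/constant_funP cst|/existsP[v /forallP/(_ true)] //].
  rewrite (_ : [forall i, _] = true) //; apply/forallP; apply: parity_constant.
  by apply/constant_funP => x y; have := cst x y; rewrite /restr_fun /sem !comp.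
have depth_hs := fdepth_gate (eq_leq dF).
have v0 : 'I_n := Ordinal n0.
have tl : Pr (rate d b) (some_deep b (h :: hs)) <=
    (fsize (Gate g h hs))%:R * expR (- (d.+1%:R / 2 * (b - 2))).
  apply: le_trans (Pr_some_deep r01 (fun h' dh' => tail v0 dh' b2) depth_hs) _.
  by rewrite ler_wpM2r ?expR_ge0 // ler_nat /=.
have av : avoid (rate d b) r (some_deep b (h :: hs))
    (fun rho => ~~ depth_lt 1 (restr_fun rho (sem (Gate g h hs)))) <= 1 / 4.
  apply: avoid_le => //.
  move=> rho sh; apply: le_trans rb; rewrite -[leRHS]expr1.
  by apply: switching_rate => //; lra.
have : 1 / 4 <= (fsize (Gate g h hs))%:R * expR (- (d.+1%:R / 2 * (b - 2))) :> R.
  by have := bound _; lra.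
rewrite expRN ler_pdivlMr ?expR_gt0 //; lra.
Qed.

End Parity.

Theorem theorem3 (R : realType) :
  exists c : R, 0 < c /\
    forall (n d : nat), (1 <= n)%N -> (1 <= d)%N ->
    forall F : formula n,
      fdepth F = d.+1 -> computes F (@parity n) ->
      expR (c * d%:R * (n%:R `^ (d%:R^-1) - 1)) <= (fsize F)%:R.
Proof.
have B16 := base_ge16 R; set K : R := 64 * base R; have K0 : 0 < K by rewrite /K; lra.
exists (8 * K)^-1; split; first by rewrite invr_gt0 mulr_gt0.
move=> n [//|d] n1 _ F dF comp.
have n1' : 1 <= n%:R :> R by rewrite ler1n.
have d1 : 1 <= d.+1%:R :> R by rewrite ler1n.
set x := n%:R `^ _.
have xn : x ^+ d.+1 = n%:R.
  rewrite -powR_mulrn ?powR_ge0 // /x -powRrM mulVf ?powRr1 //; lra.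
have x1 : 1 <= x by rewrite /x -[leLHS](powRr0 n%:R); apply: ler_powR => //; rewrite invr_ge0; lra.
have xln : d.+1%:R * ln x = ln n%:R by rewrite /x ln_powR; field; lra.
(* The constant [8 * K] is chosen so that the first case has [b >= 8]. *)
have [xK|xK] := leP (8 * K) x.
  pose b := x / K.
  have bx : b * K = x by rewrite /b; field; lra.
  have b8 : 8 <= b by rewrite /b ler_pdivlMr.
  have := @parity_size_large R n d F b n1 _ dF comp.
  rewrite -/K mulrC bx => /(_ _ xn); have b2 : 2 < b by lra.
  move=> /(_ b2) large.
  (* As [b >= 8], the right exponent exceeds [d.+1 / 8 * b] by at least 2, and [expR 2 >= 4] absorbs
     the constant of [parity_size_large]. *)
  have e4 : 4 * expR ((8 * K)^-1 * d.+1%:R * (x - 1)) <= expR (d.+1%:R / 2 * (b - 2)).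
    apply: (@le_trans _ _ (expR 2 * expR (d.+1%:R / 8 * b))).
      apply: ler_pM; rewrite ?expR_ge0 //.
        have := @expR_ge1Dx R 1; rewrite -[2]/(1 + 1) expRD; nra.
      rewrite ler_expR (_ : d.+1%:R / 8 * b = (8 * K)^-1 * d.+1%:R * x); last first.
        by rewrite -bx; field; lra.
      by rewrite ler_wpM2l ?mulr_ge0 ?invr_ge0 //; lra.
    by rewrite -expRD ler_expR; nra.
  by lra.
(* Depth at least 2 makes the root a gate. For [x < 8 * K], the chain
   [x - 1 <= x * ln x <= 8 * K * ln x] brings the exponent below [ln n]. *)
have nF : n%:R <= (fsize F)%:R :> R.
  rewrite ler_nat; case: F dF comp => // g h hs _; exact: parity_size.
apply: le_trans nF.
rewrite -[leRHS]lnK ?posrE; last by lra.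
rewrite ler_expR -xln.
have lnx : x - 1 <= x * ln x.
  have := expR_ge1Dx (- ln x); rewrite expRN lnK ?posrE; last by lra.
  move=> h; have : x * (1 + - ln x) <= x * x^-1 by rewrite ler_wpM2l //; lra.
  by rewrite mulfV; lra.
have ln0 : 0 <= ln x by rewrite ln_ge0.
rewrite mulrAC mulrC ler_wpM2l // ler_pdivrMl ?mulr_gt0 //.
by apply: le_trans lnx _; rewrite ler_wpM2r // ltW.
Qed.
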